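(* For every $h\ge2$, the number of addends of the polynomial expansion of the minimal winning quota $q_h$ of a parsimonious game with $h$ types is the $h$-th Fibonacci number $F_h$.
   Context: Fibonacci numbers: $F_1=F_2=1$, $F_m=F_{m-1}+F_{m-2}$ for $m\ge 3$. A parsimonious game ($P$ game) with $h$ types is a certain kind of constant sum homogeneous weighted majority game, described by its free type representation $(x_1,\ldots,x_{h-1})$, where $x_t$ is the number of players of the $t$-th smallest weight; its minimal winning quota $q_h(x_1,\ldots,x_{h-1})$ has the following polynomial expansion, to which the claim refers. For each positive integer $s<h$ let $I(h,s)$ be the set of all sequences $(i_1,\ldots,i_s)$ of positive integers such that $i_1$ is odd, $i_j<i_{j+1}$ and $i_j+i_{j+1}$ is odd for $j=1,\ldots,s-1$, and $i_s<h$. The polynomial expansion of $q_h$ is $$q_h=\sum_{\substack{1\le s<h\\ s \text{ odd}}}\ \sum_{(i_1,\ldots,i_s)\in I(h,s)}\ \prod_{j=1}^{s}x_{i_j}\quad (h\text{ even}),\qquad q_h=1+\sum_{\substack{2\le s<h\\ s \text{ even}}}\ \sum_{(i_1,\ldots,i_s)\in I(h,s)}\ \prod_{j=1}^{s}x_{i_j}\quad (h\text{ odd}).$$ Its addends are the products $\prod_{j=1}^s x_{i_j}$, one for each admissible sequence $(i_1,\ldots,i_s)$, together with the constant $1$ when $h$ is odd. So the number of addends is $\sum_{s \text{ odd},\,1\le s<h}|I(h,s)|$ for $h$ even and $1+\sum_{s\text{ even},\,2\le s<h}|I(h,s)|$ for $h$ odd. *)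

(* Defs.v *)
From HB Require Import structures.
From mathcomp Require Import all_boot all_order all_algebra.
From mathcomp Require Import mpoly.

Set Implicit Arguments.
Unset Strict Implicit.
Unset Printing Implicit Defensive.

Import GRing.Theory.

(* The value at 0 is a convention; it yields fib 1 = fib 2 = 1. *)
Fixpoint fib (m : nat) : nat :=
  if m is m1.+1 then
    if m1 is m2.+1 then fib m1 + fib m2 else 1
  else 0.

(* The list i is (i_1, ..., i_s).  The defaults 0 of head and last are used
   only by the empty list, which is not admissible since 0 is even. *)
Definition admissible (h : nat) (i : seq nat) : bool :=
  [&& all (fun k => 0 < k) i,
      odd (head 0 i),
      sorted (fun a b => (a < b) && odd (a + b)) i &
      last 0 i < h].

(* The carrier 'I_h loses nothing: an admissible sequence is increasing with
   last term less than h, so all its terms are less than h (see mem_Iset). *)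
Definition Iset (h s : nat) : {set s.-tuple 'I_h} :=
  [set i : s.-tuple 'I_h | admissible h (map val i)].

Lemma mem_Iset (h : nat) (i : seq nat) :
  admissible h i -> exists2 t, t \in Iset h (size i) & map val t = i.
Proof.
move=> adm; have /and4P[_ _ srt lst] := adm.
have lt_h : all (fun k => k < h) i.
  case: i srt lst {adm} => //= a i; elim: i a => [|b i IHi] a /=; first by move=> _ ->.
  case/andP=> /andP[ltab _] pth lst.
  have /= allb := IHi b pth lst.
  by rewrite allb andbT; case/andP: allb => /(ltn_trans ltab).
have valK : map val (pmap insub i : seq 'I_h) = i.
  rewrite pmap_filter; last exact: insubK.
  by apply/all_filterP; apply: sub_all lt_h => k ltk; rewrite insubT.
have sz : size (pmap insub i : seq 'I_h) == size i by rewrite -{2}valK size_map.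
by exists (Tuple sz); rewrite ?inE /= valK.
Qed.

(* The free types x_1, ..., x_(h-1) are the variables 'X_t with t : 'I_h and
   t > 0; the variable of index 0 does not occur when i is in Iset h s. *)
Definition addend (h s : nat) (i : s.-tuple 'I_h) : {mpoly int[h]} :=
  (\prod_(j < s) 'X_(tnth i j))%R.

(* The polynomial expansion of the minimal winning quota. *)
Definition quota (h : nat) : {mpoly int[h]} :=
  (if odd h then
    1 + \sum_(2 <= s < h | ~~ odd s) \sum_(i in Iset h s) addend i
  else
    \sum_(1 <= s < h | odd s) \sum_(i in Iset h s) addend i)%R.

Definition addends (h : nat) : seq {mpoly int[h]} :=
  (if odd h then
    1 :: [seq addend i |
            s <- [seq s <- index_iota 2 h | ~~ odd s], i <- enum (Iset h s)]
  else
    [seq addend i |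
       s <- [seq s <- index_iota 1 h | odd s], i <- enum (Iset h s)])%R.

Lemma sum_addends (h : nat) : (\sum_(p <- addends h) p = quota h)%R.
Proof.
rewrite /addends /quota; case: ifP => _;
  rewrite ?big_cons big_allpairs_dep big_filter;
  [congr (_ + _)%R|]; by apply: eq_bigr => s _; rewrite big_enum.
Qed.

(* Main.v *)
Require Import Defs.
From mathcomp Require Import all_boot.
From mathcomp Require Import zify.

(** An admissible sequence satisfies [i_j = j] modulo 2.  Let [T h] be the set
    of admissible sequences below [h], together with the empty one, whose length
    [s] has the parity of [h - 1]; the constant addend 1 for odd [h] is the empty
    product.  If a sequence of [T (h + 2)] ends with [h + 1], removing this term
    leaves an arbitrary element of [T (h + 1)]; otherwise its last term, which
    has the parity of [h + 1], is not [h], so that the sequence lies in [T h].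
    Hence the cardinals of the [T h] satisfy the Fibonacci recurrence. *)

Definition weakly_admissible (h : nat) (i : seq nat) : bool :=
  (i == [::]) || admissible h i.

(** Lists the set [T h] along the recursive splitting itself, so that the Fibonacci recurrence for
    its size is immediate. *)
Fixpoint quota_seqs (h : nat) : seq (seq nat) :=
  if h is h1.+1 then
    if h1 is h2.+1 then
      quota_seqs h2 ++ [seq rcons i h1 | i <- quota_seqs h1]
    else [:: [::]]
  else [::].

Lemma nat_ind2 (P : nat -> Prop) :
  P 0 -> P 1 -> (forall n, P n -> P n.+1 -> P n.+2) -> forall n, P n.
Proof.
move=> P0 P1 PS n; suff [] : P n /\ P n.+1 by [].
by elim: n => [|n [Pn Pn1]]; split=> //; apply: PS.
Qed.

Lemma size_quota_seqs (h : nat) : size (quota_seqs h) = fib h.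
Proof.
elim/nat_ind2: h => // h IH0 IH1.
by rewrite [LHS]/= size_cat size_map -/(quota_seqs h.+1) IH0 IH1 addnC.
Qed.

Lemma admissible_nil (h : nat) : admissible h [::] = false.
Proof. by []. Qed.

(** For empty [i] the default [last 0 i = 0] turns the parity condition between neighbours into the
    requirement that the first term be odd. *)
Lemma admissible_rcons (h : nat) (i : seq nat) (k : nat) :
  admissible h (rcons i k) =
  [&& weakly_admissible k i, odd (last 0 i + k) & k < h].
Proof.
case: i => [|a i]; rewrite /weakly_admissible /admissible.
  by rewrite /= add0n andbT; case: k.
rewrite /= all_rcons rcons_path last_rcons /=.
by case: k => [|k]; rewrite ?ltn0 ?andbF //= -!andbA; do !bool_congr.
Qed.

(** The terms start odd, alternate in parity and increase strictly from at least 1. *)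
Lemma weakly_admissible_last {h : nat} {i : seq nat} :
  weakly_admissible h i ->
  odd (last 0 i) = odd (size i) /\ size i <= last 0 i.
Proof.
elim/last_ind: i h => // i k IH h.
rewrite /weakly_admissible -size_eq0 size_rcons /= admissible_rcons last_rcons.
case/and3P=> wi odd_k _; have [eq_odd le_size] := IH k wi.
have lt_last : i = [::] \/ last 0 i < k.
  by case/orP: wi => [/eqP|/and4P[_ _ _]]; [left | right].
rewrite oddD eq_odd in odd_k; split; first by move: odd_k => /=; do 2!case: odd.
case: lt_last => [i0 | ]; last exact: leq_ltn_trans.
by move: odd_k; rewrite i0; case: (k).
Qed.

(** Makes the bounds on [s] in the index ranges of [addends] automatic. *)
Lemma admissible_size_lt {h : nat} {i : seq nat} :
  admissible h i -> 0 < size i < h.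
Proof.
move=> adm; have [|_ le_size] := @weakly_admissible_last h i.
  by rewrite /weakly_admissible adm orbT.
have /and4P[_ _ _ /(leq_ltn_trans le_size) ->] := adm.
by rewrite andbT; case: i adm {le_size}.
Qed.

Lemma mem_quota_seqs (h : nat) (i : seq nat) :
  (i \in quota_seqs h) = weakly_admissible h i && (odd (size i) != odd h).
Proof.
elim/nat_ind2: h i => [|| h IH0 IH1] i.
- rewrite in_nil; symmetry; apply/negP.
  by case/andP=> /orP[/eqP-> //|/admissible_size_lt]; rewrite ltn0 andbF.
- rewrite inE /weakly_admissible; case: eqP => [-> //|_] /=.
  symmetry; apply/negP => /andP[/admissible_size_lt]; lia.
rewrite [quota_seqs _]/= mem_cat IH0 -/(quota_seqs h.+1) /= negbK.
elim/last_ind: i => [|i k _].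
  rewrite [X in _ || X](_ : _ = false) ?orbF //.
  by apply/mapP => -[j _ /(congr1 size)]; rewrite size_rcons.
have -> : (rcons i k \in [seq rcons j h.+1 | j <- quota_seqs h.+1]) =
          (k == h.+1) && (i \in quota_seqs h.+1).
  apply/mapP/andP => [[j jT /rcons_inj[-> ->]] | [/eqP-> iT]]; last by exists i.
  by rewrite eqxx.
rewrite IH1 /weakly_admissible -size_eq0 size_rcons /= !admissible_rcons.
have [->|neq_k] /= := eqVneq k h.+1.
  rewrite ltnNge leqnSn !andbF /= ltnSn andbT.
  case wi: (weakly_admissible h.+1 i) => //=; last first.
    by move: wi; rewrite /weakly_admissible => ->.
  (* The parity condition on appending [h.+1] to [i] now coincides with the one on the length of
     [i]. *)
  have [eq_odd _] := weakly_admissible_last wi.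
  rewrite -/(weakly_admissible h.+1 i) wi oddD eq_odd /=.
  by do 2!case: odd.
rewrite orbF; case wi: (weakly_admissible k i) => //=.
have [eq_odd _] := weakly_admissible_last wi.
(* A last term [k = h] has the wrong parity for the length; any other [k] below [h.+2] is below
   [h]. *)
rewrite oddD eq_odd; have [->|neq_kh] := eqVneq k h.
  by rewrite ltnn andbF; do 2!case: odd; rewrite ?andbF.
by have -> : (k < h.+2) = (k < h) by lia.
Qed.

Lemma uniq_quota_seqs (h : nat) : uniq (quota_seqs h).
Proof.
elim/nat_ind2: h => // h IH0 IH1.
rewrite [quota_seqs _]/= cat_uniq -/(quota_seqs h.+1) IH0.
rewrite map_inj_uniq ?IH1 ?andbT; last by move=> i j /rcons_inj[].
(* The two parts are disjoint: a sequence ending with [h.+1] is not admissible below [h]. *)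
apply/hasPn => _ /mapP[i _ ->]; rewrite mem_quota_seqs /weakly_admissible.
by rewrite -size_eq0 size_rcons admissible_rcons ltnNge leqnSn !andbF.
Qed.

(** Index sequences replace the monomials, so that no distinctness of polynomials has to be
    shown. *)
Definition Iset_seqs (h : nat) (r : seq nat) : seq (seq nat) :=
  [seq map val (i : s.-tuple 'I_h) | s <- r, i <- enum (Iset h s)].

Lemma mem_Iset_seqs (h : nat) (r i : seq nat) :
  (i \in Iset_seqs h r) = (size i \in r) && admissible h i.
Proof.
apply/allpairsPdep/andP => [[s [t [sr]]] | [ir adm]].
  by rewrite mem_enum inE => adm ->; rewrite size_map size_tuple.
have [t tI eq_i] := mem_Iset adm.
by exists (size i), t; rewrite mem_enum eq_i.
Qed.

Lemma uniq_Iset_seqs (h : nat) (r : seq nat) : uniq r -> uniq (Iset_seqs h r).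
Proof.
move=> uniq_r; apply: allpairs_uniq_dep => // [s _|]; first exact: enum_uniq.
move=> [s t] [s' t'] _ _ /= eq_tt'.
have eq_s : s = s' by move: (congr1 size eq_tt'); rewrite !size_map !size_tuple.
case: s' / eq_s t' eq_tt' => t' /(inj_map val_inj) eq_t.
by congr Tagged; apply: val_inj.
Qed.

Theorem proposition6p2 (h : nat) (hh : 2 <= h) : size (addends h) = fib h.
Proof.
(* The empty sequence in [c] stands for the constant addend 1. *)
pose c := if odd h then [:: [::]] else [::] : seq (seq nat).
pose r := if odd h then [seq s <- index_iota 2 h | ~~ odd s]
          else [seq s <- index_iota 1 h | odd s].
have -> : size (addends h) = size (c ++ Iset_seqs h r).
  by rewrite /addends /c /r; case: ifP => _; rewrite /= !size_allpairs_dep.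
rewrite -size_quota_seqs; apply/perm_size/uniq_perm; last 1 first.
- move=> i; rewrite mem_cat mem_Iset_seqs mem_quota_seqs /weakly_admissible /c /r.
  case: (eqVneq i [::]) => [->|i0].
    by rewrite admissible_nil andbF orbF; case: (odd h).
  case adm: (admissible h i); last by case: (odd h); rewrite ?inE ?(negPf i0) ?andbF.
  have size_i := admissible_size_lt adm.
  case odd_h: (odd h); rewrite ?inE ?(negPf i0) mem_filter mem_index_iota /=; lia.
- have -> : uniq (c ++ Iset_seqs h r) = uniq (Iset_seqs h r).
    by rewrite /c; case: (odd h) => //=; rewrite mem_Iset_seqs admissible_nil andbF.
  by apply: uniq_Iset_seqs; rewrite /r; case: ifP => _; apply/filter_uniq/iota_uniq.
- exact: uniq_quota_seqs.
Qed.
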